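(* Let $a>0$, $l\in\mathbb{R}$, $C_\ast>0$ and $q>1$. Assume that $u:\mathbb{R}^3\to\mathbb{R}$ is a uniformly continuous and differentiable solution of $$u(x)=l+C_\ast\int_{\mathbb{R}^3}\mathcal{K}_a(x-y)\,u^{q-1}(y)\big(1-u^q(y)\big)\,dy,\quad x\in\mathbb{R}^3,$$ and that $$0\le u\le 1\ \text{ on }\mathbb{R}^3\qquad\text{and}\qquad\int_{\mathbb{R}^3}u^{q-1}(1-u^q)\,dx<\infty.$$ Then: (i) if $u\in L^{q-1}(\mathbb{R}^3)$ and $l=0$, and $1<q\le 6$, then $u\equiv 0$; (ii) if $1-u^q\in L^1(\mathbb{R}^3)$ and $l=1$, then $u\equiv 1$.
   Context: For $a>0$, $\mathcal{K}_a(x)=\frac{1-e^{-|x|/a}}{|x|}$ for $x\in\mathbb{R}^3\setminus\{0\}$. $u\in L^{q-1}(\mathbb{R}^3)$ means $\int_{\mathbb{R}^3}|u|^{q-1}\,dx<\infty$ (also when $q-1<1$). *)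

(* Defs.v *)
From HB Require Import structures.
From mathcomp Require Import all_boot all_order all_algebra.
From mathcomp Require Import all_classical all_reals all_analysis.

Set Implicit Arguments.
Unset Strict Implicit.
Unset Printing Implicit Defensive.

Import Order.TTheory GRing.Theory Num.Theory.
Import numFieldNormedType.Exports.

Local Open Scope ring_scope.

(* R^3 is R * R * R. The topology, uniform structure and normed-module
   structure inferred on this type are those of the sup norm, which is
   equivalent to [norm3]; hence uniform continuity and differentiability have
   their usual meaning. The norm notation of the library would denote the
   sup norm, so the Euclidean norm has to be defined. *)
Definition norm3 (R : realType) (x : R * R * R) : R :=
  Num.sqrt (x.1.1 ^+ 2 + x.1.2 ^+ 2 + x.2 ^+ 2).

(* Lebesgue measure on R^3 (on the Borel sets). *)
Definition lebesgue_measure3 (R : realType) :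
  {measure set (measurableTypeR R * measurableTypeR R * measurableTypeR R)
     -> \bar R} :=
  ((@lebesgue_measure R \x @lebesgue_measure R) \x @lebesgue_measure R)%E.

(* Division by zero makes this 0 at the origin, where the kernel is left
   undefined; the origin is a null set. *)
Definition calK (R : realType) (a : R) (x : R * R * R) : R :=
  (1 - expR (- (norm3 x / a))) / norm3 x.

(* Main.v *)
(* Part (ii) is immediate: the integral is nonnegative, so l <= u <= 1.

   For part (i), let f(s) = s^(q-1) (1 - s^q) and F(s) = s^q/q - s^(2q)/(2q), so
   that F' = f. If u vanishes at one point, then f(u) = 0 almost everywhere, by
   positivity of the kernel K, and hence u = 0. So assume u > 0 everywhere. The
   Pohozaev argument is carried out on the integral equation itself: multiplying
   u = C K * f(u) by f(u) and applying the generator of dilations gives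
     -3 int F(u) = C/2 iint (x - y).grad K(x - y) f(u(x)) f(u(y)) dx dy,
   after integration by parts on the left and exchange of x and y on the right.
   Since z.grad K(z) = e^(-|z|/a)/a - K(z) >= - K(z) and f(u) >= 0, this yields
   3 int F(u) <= 1/2 int u f(u), whereas 3 F(s) > s f(s) / 2 for 0 < s <= 1 as
   soon as q <= 6.

   To make the integrals converge, each component x_i of the dilation field is
   truncated to [-N, N]; truncation is monotone and 1-Lipschitz, so the lower
   bound on the kernel survives, and N tends to infinity at the end. The
   integration by parts is a translation of difference quotients, whose limit
   is dominated thanks to the bound |K(z + te) - K(z)| <= (2/a) |t| K(z), which
   transfers to u. *)
Require Import Defs.
From HB Require Import structures.
From mathcomp Require Import all_boot all_order all_algebra.
From mathcomp Require Import all_classical all_reals all_analysis.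
From mathcomp Require Import measurable_realfun ring lra.
Set Implicit Arguments.
Unset Strict Implicit.
Unset Printing Implicit Defensive.
Import Order.TTheory GRing.Theory Num.Theory.
Import numFieldNormedType.Exports.
Local Open Scope classical_set_scope.
Local Open Scope ring_scope.

(** * The radial profile of the kernel and the nonlinearity *)

Section Profile.
Context {R : realType}.
Implicit Types s t : R.

(** Radial profile of the kernel, which at [z] equals [phi (norm3 z / a) / a]. Division by zero
    makes [phi 0 = 0], in agreement with [calK] at the origin. *)
Definition phi s : R := (1 - expR (- s)) / s.
(** This is [- phi'] on the positive half-line; hence z.grad K(z) equals [- psi s * s / a] at
    [s = norm3 z / a]. *)
Definition psi s : R := (1 - expR (- s) - s * expR (- s)) / s ^+ 2.

Lemma oneBexpRN_ge0 s : 0 <= s -> 0 <= 1 - expR (- s).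
Proof. by move=> s0; rewrite subr_ge0 expR_le1 oppr_le0. Qed.

Lemma oneBexpRN_le s : 1 - expR (- s) <= s.
Proof. have := expR_ge1Dx (- s); lra. Qed.

Lemma oneBexpRN_ge s : 0 <= s -> s <= (1 + s) * (1 - expR (- s)).
Proof.
move=> s0; have h : (1 + s) * expR (- s) <= 1.
  by rewrite expRN ler_pdivrMr ?expR_gt0// mul1r expR_ge1Dx.
lra.
Qed.

Lemma phi_ge0 s : 0 <= s -> 0 <= phi s.
Proof. by move=> s0; rewrite divr_ge0// oneBexpRN_ge0. Qed.

Lemma phi_gt0 s : 0 < s -> 0 < phi s.
Proof.
by move=> s0; rewrite divr_gt0// subr_gt0 expR_lt1 oppr_lt0.
Qed.

Lemma phi_le1 s : 0 <= s -> phi s <= 1.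
Proof.
rewrite le_eqVlt => /predU1P[<-|s0]; first by rewrite /phi invr0 mulr0.
by rewrite ler_pdivrMr// mul1r oneBexpRN_le.
Qed.

(* Integrated form of [`|phi'| <= 2 * phi]. *)
Lemma phi_lip_le s t : 0 < s -> s <= t ->
  0 <= phi s - phi t <= 2 * (t - s) * phi t.
Proof.
move=> s0 st; have t0 : 0 < t by exact: lt_le_trans st.
have [h h0 tE] : exists2 h, 0 <= h & t = s + h.
  by exists (t - s); rewrite ?subr_ge0// addrC subrK.
have hE : t - s = h by rewrite tE addrAC subrr add0r.
(* Over a common denominator only e^(-s) and e^(-h), with [h = t - s], remain; the elementary bounds
   on 1 - e^(-x) then control the numerator. *)
have E : phi s - phi t =
    (h * (1 - expR (- s)) - s * expR (- s) * (1 - expR (- h))) / (s * t).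
  rewrite -mulrA; have -> : expR (- s) * (1 - expR (- h)) = expR (- s) - expR (- t).
    by rewrite mulrBr mulr1 -expRD -opprD tE.
  rewrite /phi -hE; field.
  by rewrite !gt_eqF.
have hs := oneBexpRN_ge h0; have hh := oneBexpRN_le h.
have es := expR_gt0 (- s); have ses := oneBexpRN_le s.
have s1 := oneBexpRN_ge (ltW s0).
have t1 := oneBexpRN_ge (ltW t0).
have est : expR (- t) <= expR (- s) by rewrite ler_expR lerN2.
set x := expR (- s) in E es ses s1 est *; set y := expR (- h) in E hs hh *.
apply/andP; split.
  rewrite E divr_ge0 ?mulr_ge0 ?(ltW s0) ?(ltW t0)//.
  have : s * x * (1 - y) <= s * x * h by rewrite ler_pM2l ?mulr_gt0.
  have : 0 <= h * (1 - x - s * x) by rewrite mulr_ge0//; lra.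
  lra.
rewrite E ler_pdivrMr ?mulr_gt0//.
have -> : 2 * (t - s) * phi t * (s * t) = 2 * h * s * (1 - expR (- t)).
  by rewrite /phi hE; field; rewrite gt_eqF.
set z := expR (- t) in t1 est *.
have z1 : 0 <= 1 - z by apply: oneBexpRN_ge0; exact: ltW.
have y1 : 0 <= s * x * (1 - y).
  by rewrite mulr_ge0 ?mulr_ge0 ?(ltW s0) ?(ltW es)//; exact: oneBexpRN_ge0.
(* For [s >= 1] the negative term is dropped and the factor [s] on the right absorbs the rest. For
   [s < 1] it is needed: both sides are multiplied by [1 + h] to use h <= (1 + h)(1 - e^(-h)), and
   [1 + t <= 2 * (1 + h)] explains the factor 2. *)
have [s_ge1|s_lt1] := leP 1 s.
  have : h * (1 - x) <= h * (1 - z) by rewrite ler_wpM2l// lerB.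
  have : h * (1 - z) * 1 <= h * (1 - z) * s by rewrite ler_wpM2l// mulr_ge0.
  have : 0 <= h * s * (1 - z) by rewrite !mulr_ge0// ltW.
  lra.
have h1 : 0 < 1 + h by lra.
rewrite -(ler_pM2r h1).
have A : h * (1 - x) <= h * s by rewrite ler_wpM2l.
have B : s * h * x <= s * x * ((1 + h) * (1 - y)).
  by rewrite -mulrA [h * x]mulrC mulrA ler_pM2l// mulr_gt0.
have D : h * s * t <= h * s * ((1 + t) * (1 - z)).
  by rewrite ler_wpM2l// mulr_ge0// ltW.
have G : h * s * ((1 + t) * (1 - z)) <= h * s * (2 * (1 + h) * (1 - z)).
  rewrite ler_wpM2l ?mulr_ge0 ?(ltW s0)// ler_wpM2r//; lra.
have I : h * (1 - x) * (1 + h) - s * h * x <= h * s * t.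
  have : s * h * (1 - s) <= s * h * x.
    apply: ler_wpM2l; [by rewrite mulr_ge0// ltW|lra].
  have : h * (1 - x) * (1 + h) <= h * s * (1 + h) by rewrite ler_pM2r.
  rewrite tE; lra.
lra.
Qed.

(** As [phi] is nonincreasing, the bound by its value at the larger argument implies the bound by
    its value at either one. *)
Lemma phi_lip s t : 0 < s -> 0 < t ->
  `|phi t - phi s| <= 2 * `|t - s| * phi s.
Proof.
move=> s0 t0; have [st|/ltW ts] := leP s t.
  have /andP[h1 h2] := phi_lip_le s0 st.
  rewrite distrC ger0_norm// ger0_norm ?subr_ge0//.
  by apply: le_trans h2 _; rewrite ler_wpM2l ?mulr_ge0 ?subr_ge0// -subr_ge0.
have /andP[h1 h2] := phi_lip_le t0 ts.
by rewrite ger0_norm// distrC ger0_norm ?subr_ge0.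
Qed.

Lemma psi_ge0 s : 0 <= s -> 0 <= psi s.
Proof.
move=> s0; rewrite divr_ge0 ?sqr_ge0//.
have h : (1 + s) * expR (- s) <= 1.
  by rewrite expRN ler_pdivrMr ?expR_gt0// mul1r expR_ge1Dx.
lra.
Qed.

Lemma psi_le1 s : 0 <= s -> psi s <= 1.
Proof.
rewrite le_eqVlt => /predU1P[<-|s0].
  by rewrite /psi expr0n/= invr0 mulr0.
rewrite ler_pdivrMr ?exprn_gt0// mul1r.
have h1 := oneBexpRN_le s.
have : s * (1 - s) <= s * expR (- s) by rewrite ler_pM2l//; lra.
rewrite expr2; lra.
Qed.

(** The difference of the two sides is e^(-s). This is the radial form of z.grad K(z) >= - K(z). *)
Lemma psi_le_phi s : 0 < s -> psi s * s <= phi s.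
Proof.
move=> s0; have -> : psi s * s = phi s - expR (- s).
  by rewrite /psi /phi; field; rewrite gt_eqF.
by rewrite gerBl expR_ge0.
Qed.

End Profile.

(** * Differentiation of the profile; the nonlinearity and its primitive *)

Section Derivatives.
Context {R : realType}.
Implicit Types s t : R.

Lemma is_derive_phi s : 0 < s -> is_derive s 1 (@phi R) (- psi s).
Proof.
move=> s0; have sN0 : s != 0 by rewrite gt_eqF.
have -> : @phi R = (cst 1 - expR \o -%R) * (fun t => (id t)^-1) by [].
have dE : is_derive s 1 (@expR R \o -%R) (expR (- s) * - 1).
  by apply: is_derive1_comp.
have dV : is_derive s 1 (fun t : R => (id t)^-1) (- s ^- 2 *: 1).
  by apply: is_deriveV.
apply: is_derive_eq.
rewrite /psi /= /GRing.scale /= !fctE /=; field.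
exact: sN0.
Qed.

(** Chain rule along a sequence. Carathéodory's form of the derivative avoids dividing by
    [s_ n - s], which may vanish. *)
Lemma diff_quotient_cvg (g : R -> R) s d (s_ t_ : nat -> R) d' :
  is_derive s 1 g d -> s_ @ \oo --> s ->
  (s_ n - s) / t_ n @[n --> \oo] --> d' ->
  (g (s_ n) - g s) / t_ n @[n --> \oo] --> d * d'.
Proof.
move=> /is_derive1_caratheodory[h [gE hc hs]] ss dd.
under eq_fun do rewrite gE -mulrA.
rewrite -hs; apply: cvgM => //.
by apply: cvg_comp ss _; exact: hc.
Qed.

Definition nonlin q s := s `^ (q - 1) * (1 - s `^ q).
Definition primitive q s := s `^ q / q - s `^ (2 * q) / (2 * q).

Lemma is_derive_primitive q s : 0 < q -> 0 < s ->
  is_derive s 1 (primitive q) (nonlin q s).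
Proof.
move=> q0 s0.
have -> : primitive q =
    (q^-1 \*: @powR R ^~ q) - ((2 * q)^-1 \*: @powR R ^~ (2 * q)).
  by apply/funext => t; rewrite /primitive !fctE /GRing.scale/= ![_ * _^-1]mulrC.
apply: is_derive_eq.
  by apply: is_deriveB; apply: is_deriveZ; exact: is_derive1_powR.
rewrite /nonlin /GRing.scale /=.
have -> : 2 * q - 1 = (q - 1) + q by ring.
rewrite (@powRD _ _ (q - 1) q); last by rewrite (gt_eqF s0) implybT.
field; by rewrite gt_eqF.
Qed.

Lemma powR_le1 p s : 0 <= p -> 0 <= s <= 1 -> s `^ p <= 1.
Proof.
move=> p0 /andP[s0 s1]; apply: le_trans (_ : 1 `^ p <= 1); last by rewrite powR1.
by rewrite ge0_ler_powR ?nnegrE.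
Qed.

Lemma nonlin_01 q s : 1 < q -> 0 <= s <= 1 -> 0 <= nonlin q s <= s `^ (q - 1).
Proof.
move=> q1 /andP[s0 s1].
have h1 : s `^ q <= 1.
  by rewrite powR_le1 ?s0 ?s1//; lra.
have h0 := powR_ge0 s q.
rewrite /nonlin mulr_ge0 ?powR_ge0//=; last by lra.
rewrite -[leRHS]mulr1 ler_wpM2l ?powR_ge0//; lra.
Qed.

Lemma primitive_lip q s t : 1 < q -> 0 < s <= 1 -> 0 < t <= 1 ->
  `|primitive q t - primitive q s| <= Num.max s t `^ (q - 1) * `|t - s|.
Proof.
move=> q1.
wlog st : s t / s <= t.
  move=> H s01 t01; have /orP[st|ts] := le_total s t; first exact: H.
  rewrite distrC maxC [`|t - s|]distrC; exact: H.
move=> /andP[s0 s1] /andP[t0 t1].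
have q0 : 0 < q by lra.
have [| |c] := @MVT_segment R (primitive q) (nonlin q) s t st.
- move=> x; rewrite in_itv/= => /andP[sx xt].
  by apply: is_derive_primitive => //; exact: lt_trans sx.
- apply: derivable_within_continuous => x; rewrite in_itv/= => /andP[sx xt].
  by have [] := is_derive_primitive q0 (lt_le_trans s0 sx).
rewrite in_itv/= => /andP[sc ct] ->.
rewrite normrM ler_wpM2r//.
have /andP[h1 h2] : 0 <= nonlin q c <= c `^ (q - 1).
  by apply: nonlin_01 => //; rewrite (le_trans (ltW s0) sc) (le_trans ct t1).
rewrite ger0_norm// (le_trans h2)//.
by rewrite ge0_ler_powR ?nnegrE ?le_max ?ct ?orbT ?(ltW s0)//; lra.
Qed.


Lemma primitive_01 q s : 1 < q -> 0 < s <= 1 -> 0 <= primitive q s <= s `^ (q - 1).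
Proof.
move=> q1 /andP[s0 s1].
have E : primitive q s = s `^ q * (1 - s `^ q / 2) / q.
  rewrite /primitive; have -> : 2 * q = q + q by ring.
  rewrite (@powRD _ _ q q); last by rewrite (gt_eqF s0) implybT.
  field; rewrite gt_eqF//; lra.
have x0 : 0 <= s `^ q by exact: powR_ge0.
have x1 : s `^ q <= 1 by rewrite powR_le1 ?(ltW s0) ?s1//; lra.
have xs : s `^ q <= s `^ (q - 1).
  by rewrite -(@mulr_powRB1 _ s q) ?(ltW s0)//; [rewrite ler_piMl ?powR_ge0|lra].
rewrite E divr_ge0 ?mulr_ge0//=; [|lra|lra].
rewrite ler_pdivrMr; last by lra.
set x := s `^ q in x0 x1 xs *; set y := s `^ (q - 1) in xs *.
have xx : 0 <= x * x by rewrite mulr_ge0.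
have : y * 1 <= y * q by rewrite ler_wpM2l ?powR_ge0// ltW.
lra.
Qed.

(** Here [q <= 6] enters. With x = s^q in ]0, 1], dividing by x leaves q (1 - x) < 6 - 3 x, and q (1
    - x) <= 6 - 6 x. *)
Lemma pohozaev_density_gt0 q s : 1 < q <= 6 -> 0 < s <= 1 ->
  s * nonlin q s / 2 < 3 * primitive q s.
Proof.
move=> /andP[q1 q6] /andP[s0 s1].
have -> : s * nonlin q s = s `^ q * (1 - s `^ q).
  by rewrite /nonlin mulrA mulr_powRB1 ?(ltW s0)//; lra.
have -> : 3 * primitive q s = s `^ q * (3 - 3 / 2 * s `^ q) / q.
  rewrite /primitive; have -> : 2 * q = q + q by ring.
  rewrite (@powRD _ _ q q); last by rewrite (gt_eqF s0) implybT.
  field; rewrite gt_eqF//; lra.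
have h0 : 0 < s `^ q by rewrite powR_gt0.
have h1 : s `^ q <= 1.
  by rewrite powR_le1 ?(ltW s0) ?s1//; lra.
set x := s `^ q in h0 h1 *.
rewrite -!mulrA ltr_pM2l// ltr_pdivlMr; last by lra.
nra.
Qed.
End Derivatives.

(** * Coordinates, Euclidean norm and measurability in three dimensions *)

Notation space R :=
  (measurableTypeR R * measurableTypeR R * measurableTypeR R)%type.

Section Space.
Context {R : realType}.
Local Notation V := (space R).
Implicit Types (x y z : R * R * R) (s t : R).

Lemma measurable_coord1 : measurable_fun [set: V] (fun x => x.1.1 : R).
Proof.
exact: (measurableT_comp (f := @fst (measurableTypeR R) (measurableTypeR R))).
Qed.

Lemma measurable_coord2 : measurable_fun [set: V] (fun x => x.1.2 : R).
Proof.
exact: (measurableT_comp (f := @snd (measurableTypeR R) (measurableTypeR R))).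
Qed.

Lemma measurable_coord3 : measurable_fun [set: V] (fun x => x.2 : R).
Proof. exact: measurable_snd. Qed.

Lemma norm3_ge0 x : 0 <= norm3 x.
Proof. exact: sqrtr_ge0. Qed.

Lemma norm3_sqr x : norm3 x ^+ 2 = x.1.1 ^+ 2 + x.1.2 ^+ 2 + x.2 ^+ 2.
Proof. by rewrite sqr_sqrtr// !addr_ge0// sqr_ge0. Qed.

Lemma norm3_eq0 x : norm3 x = 0 -> x = 0.
Proof.
move=> h; have := norm3_sqr x; rewrite h expr0n/= => /esym/eqP.
rewrite !paddr_eq0 ?addr_ge0 ?sqr_ge0// !sqrf_eq0.
by case: x {h} => [[x1 x2] x3]/= /andP[/andP[/eqP-> /eqP->] /eqP->].
Qed.

Lemma norm3N x : norm3 (- x) = norm3 x.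
Proof. by rewrite /norm3 /= !sqrrN. Qed.

Lemma measurable_norm3 : measurable_fun [set: V] (@norm3 R).
Proof.
apply: (measurableT_comp (f := @Num.sqrt R)).
  by apply: continuous_measurable_fun; exact: sqrt_continuous.
by apply: measurable_funD; [apply: measurable_funD|];
  apply: measurable_funX;
  [exact: measurable_coord1|exact: measurable_coord2|exact: measurable_coord3].
Qed.

(* [pi] is a coordinate and [e t] is the vector with this coordinate [t] and
   the others [0]. *)
Definition axis (pi : R * R * R -> R) (e : R -> R * R * R) :=
  [/\ measurable_fun [set: V] pi,
      forall x y, pi (x - y) = pi x - pi y,
      forall z t, pi (z + e t) = pi z + t,
      forall z t, norm3 (z + e t) ^+ 2 = norm3 z ^+ 2 + 2 * t * pi z + t ^+ 2 &
      forall z, `|pi z| <= norm3 z].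

Lemma axis1 : axis (fun x => x.1.1) (fun t => (t, 0, 0)).
Proof.
split=> //=; first exact: measurable_coord1.
  by move=> z t; rewrite !norm3_sqr/=; ring.
by move=> z; rewrite -sqrtr_sqr ler_wsqrtr// -addrA lerDl addr_ge0// sqr_ge0.
Qed.

Lemma axis2 : axis (fun x => x.1.2) (fun t => (0, t, 0)).
Proof.
split=> //=; first exact: measurable_coord2.
  by move=> z t; rewrite !norm3_sqr/=; ring.
by move=> z; rewrite -sqrtr_sqr ler_wsqrtr// addrAC lerDr addr_ge0// sqr_ge0.
Qed.

Lemma axis3 : axis (fun x => x.2) (fun t => (0, 0, t)).
Proof.
split=> //=; first exact: measurable_coord3.
  by move=> z t; rewrite !norm3_sqr/=; ring.
by move=> z; rewrite -sqrtr_sqr ler_wsqrtr// lerDr addr_ge0// sqr_ge0.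
Qed.

(** Squaring reduces this to [|pi z| <= norm3 z], which takes the place of the Cauchy-Schwarz
    inequality for a vector on the axis. *)
Lemma axis_norm3_lip pi e : axis pi e ->
  forall z t, `|norm3 (z + e t) - norm3 z| <= `|t|.
Proof.
move=> [_ _ _ nE np] z t.
have n0 := norm3_ge0 z; have m0 := norm3_ge0 (z + e t).
have tpi : `|t * pi z| <= `|t| * norm3 z by rewrite normrM ler_wpM2l.
have t2 : `|t| ^+ 2 = t ^+ 2 by rewrite real_normK ?num_real.
have /andP[tp1 tp2] : - (`|t| * norm3 z) <= t * pi z <= `|t| * norm3 z.
  by rewrite -ler_norml.
have hE := nE z t.
rewrite ler_norml; apply/andP; split.
  rewrite lerNl opprB lerBlDr.
  have [h|h] := leP (norm3 z) `|t|; first by rewrite (le_trans h)// lerDl.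
  rewrite -lerBlDl -ler_sqr ?nnegrE ?subr_ge0 ?(ltW h)// hE sqrrB; lra.
rewrite lerBlDr -ler_sqr ?nnegrE ?addr_ge0// hE sqrrD; lra.
Qed.

Lemma measurable_addr (v : R * R * R) :
  measurable_fun [set: V] (fun x : V => x + v : V).
Proof.
have mD (c : R) : measurable_fun [set: measurableTypeR R]
    (fun s : measurableTypeR R => (s + c)%R : measurableTypeR R).
  by apply: (@measurable_funD _ _ R) => //.
apply: measurable_fun_pair; last by apply: (measurableT_comp (mD _)).
apply: measurable_fun_pair.
by apply: (measurableT_comp (mD _)); exact: measurable_coord1.
by apply: (measurableT_comp (mD _)); exact: measurable_coord2.
Qed.

Lemma measurable_subr : measurable_fun [set: V * V] (fun p : V * V => p.1 - p.2 : V).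
Proof.
have h (pi : V -> R) : measurable_fun [set: V] pi ->
  measurable_fun [set: V * V] (fun p : V * V => pi p.1 - pi p.2 : R).
  by move=> mpi; apply: measurable_funB; apply: measurableT_comp.
apply: measurable_fun_pair; last exact: h measurable_coord3.
apply: measurable_fun_pair.
exact: h measurable_coord1. exact: h measurable_coord2.
Qed.

End Space.

(** * Lebesgue measure on the three-dimensional space *)

Section MeasurePreserving.
Context d (T : measurableType d) {R : realType}.
Variables (mu : {measure set T -> \bar R}) (h : T -> T).
Hypothesis mh : measurable_fun [set: T] h.
Hypothesis hmu : forall A, measurable A -> mu (h @^-1` A) = mu A.

(** The pushforward of [mu] under [h] is [mu] itself. Change of variables is applied first to the
    absolute value, for integrability, and then to [g]. *)
Lemma integral_measure_preserving (g : T -> \bar R) : mu.-integrable [set: T] g ->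
  mu.-integrable [set: T] (fun x => g (h x)) /\
  (\int[mu]_x g (h x))%E = (\int[mu]_x g x)%E.
Proof.
move=> ig; have /integrableP[mg gfin] := ig.
have mag : measurable_fun [set: T] (abse \o g) by exact: measurableT_comp.
have ig' : mu.-integrable [set: T] (fun x => g (h x)).
  apply/integrableP; split; first exact: measurableT_comp mg mh.
  have H := ge0_integral_pushforward mh mu measurableT mag.
  rewrite preimage_setT in H.
  have -> : (\int[mu]_x `|g (h x)| = \int[pushforward mu h]_x `|g x|)%E.
    by rewrite H// => x _; exact: abse_ge0.
  by rewrite (eq_measure_integral mu)// => A mA _; exact: hmu.
split=> //.
have := integral_pushforward mh (mu := mu) mg ig' measurableT.
rewrite preimage_setT => <-.
by apply: eq_measure_integral => A mA _; exact: hmu.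
Qed.

End MeasurePreserving.

Section SigmaFinite.
Context {R : realType}.
Local Notation l := (@lebesgue_measure R).

Definition lebesgue_measure2 : {measure set
  (measurableTypeR R * measurableTypeR R)%type -> \bar R} := (l \x l)%E.

(* Sigma-finiteness of a product of sigma-finite measures is not inferred. *)
Definition lebesgue_measure2_sfinite := Measure_isSigmaFinite.Build _ _ _
  (Measure.sort lebesgue_measure2)
  (@lebesgue_integral_fubini.product_measure_sigma_finite_subproof
     _ _ _ _ _ l l).

Definition lebesgue2 : {sigma_finite_measure set
  (measurableTypeR R * measurableTypeR R)%type -> \bar R} :=
  HB.pack (Measure.sort lebesgue_measure2) lebesgue_measure2_sfinite.

Definition lebesgue_measure3_sfinite := Measure_isSigmaFinite.Build _ _ _
  (Measure.sort (@lebesgue_measure3 R))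
  (@lebesgue_integral_fubini.product_measure_sigma_finite_subproof
     _ _ _ _ _ lebesgue2 l).

(** The same measure as [lebesgue_measure3], carrying the sigma-finiteness that Fubini's theorem
    requires. *)
Definition lebesgue3 : {sigma_finite_measure set (space R) -> \bar R} :=
  HB.pack (Measure.sort (@lebesgue_measure3 R)) lebesgue_measure3_sfinite.

End SigmaFinite.

Section Lebesgue3.
Context {R : realType}.
Local Notation V := (space R).
Local Notation mu := (@lebesgue_measure3 R).
Local Notation l := (@lebesgue_measure R).
Implicit Types (x y z v : R * R * R) (s t c : R).

Lemma measurable_addc c :
  measurable_fun [set: measurableTypeR R]
    (fun s => (s + c)%R : measurableTypeR R).
Proof. by apply: (@measurable_funD _ _ R). Qed.

(** The translated measure agrees with Lebesgue measure on half-open intervals, which determine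
    it. *)
Lemma lebesgue_measure_shift c (A : set (measurableTypeR R)) : measurable A ->
  lebesgue_measure ((fun s => s + c) @^-1` A) = lebesgue_measure A :> \bar R.
Proof.
move=> mA; apply/esym.
apply: (@lebesgue_measure_unique _
  (pushforward lebesgue_measure
    (fun s : measurableTypeR R => s + c : measurableTypeR R))) => //.
  exact: measurable_addc.
move=> mshift X [[a b]/= ab <-]; rewrite /pushforward/=.
have -> : (fun s : R => s + c) @^-1` `]a, b] = `]a - c, b - c]%classic.
  by apply/seteqP; split => s /=; rewrite !in_itv/= ltrBlDr lerBrDr.
rewrite !lebesgue_measure_itv/= !lte_fin ltrD2r -!EFinD.
by case: ifPn => // _; congr (_%:E); ring.
Qed.

(** Uniqueness of product measures, used first for the plane and then for the product of the plane
    with the line: on rectangles the claim is one-dimensional. *)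
Lemma lebesgue_measure3_shift v (A : set V) : measurable A ->
  mu ((fun x => x + v) @^-1` A) = mu A.
Proof.
move=> mA; apply/esym.
case: v => [[v1 v2] v3].
have m12 : measurable_fun [set: measurableTypeR R * measurableTypeR R]
   (fun p : measurableTypeR R * measurableTypeR R =>
     (p.1 + v1, p.2 + v2) : measurableTypeR R * measurableTypeR R).
  by apply: measurable_fun_pair; apply: (measurableT_comp (measurable_addc _)).
have H12 (B : set (measurableTypeR R * measurableTypeR R)) : measurable B ->
    (l \x l)%E ((fun p => (p.1 + v1, p.2 + v2)) @^-1` B) = (l \x l)%E B.
  move=> mB; apply/esym.
  apply: (@product_measure_unique _ _ _ _ _ l l
    (pushforward (l \x l)%E
    (fun p : measurableTypeR R * measurableTypeR R =>
     (p.1 + v1, p.2 + v2) : measurableTypeR R * measurableTypeR R)))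
    => // B1 B2 mB1 mB2.
  rewrite /pushforward /=.
  transitivity ((l \x l)%E
    (((fun s => s + v1) @^-1` B1) `*` ((fun s => s + v2) @^-1` B2))) => //.
  rewrite product_measure1E.
  - by congr (_ * _)%E; exact: lebesgue_measure_shift.
  - by rewrite -[X in measurable X]setTI; exact: measurable_addc.
  - by rewrite -[X in measurable X]setTI; exact: measurable_addc.
have m3 := @measurable_addr R (v1, v2, v3).
have H := @product_measure_unique _ _ _ _ _ (@lebesgue2 R) l
    (pushforward mu (fun x : V => x + (v1, v2, v3) : V)).
apply: H => // B1 B2 mB1 mB2.
rewrite /pushforward /=.
transitivity ((@lebesgue2 R \x l)%E (((fun p => (p.1 + v1, p.2 + v2)) @^-1` B1) `*`
  ((fun s => s + v3) @^-1` B2))) => //.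
rewrite product_measure1E.
- by congr (_ * _)%E; [exact: H12|exact: lebesgue_measure_shift].
- by rewrite -[X in measurable X]setTI; exact: m12.
- by rewrite -[X in measurable X]setTI; exact: measurable_addc.
Qed.

Lemma Rintegral_shift v (g : R * R * R -> R) :
  (@lebesgue3 R).-integrable setT (EFin \o g) ->
  (@lebesgue3 R).-integrable setT (EFin \o (fun x => g (x + v))) /\
  \int[@lebesgue3 R]_x g (x + v) = \int[@lebesgue3 R]_x g x.
Proof.
move=> ig.
have [ig' E] := integral_measure_preserving (measurable_addr v)
  (@lebesgue_measure3_shift v) ig.
by split=> //; congr fine.
Qed.

Lemma lebesgue_measure3_set1 v : mu [set v] = 0%E.
Proof.
case: v => [[v1 v2] v3].
have -> : [set (v1, v2, v3)] = ([set v1] `*` [set v2]) `*` [set v3].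
  by apply/seteqP; split=> [_ -> //|[[a b] c]/= [[-> ->] ->]].
transitivity ((@lebesgue2 R \x l)%E ([set v1] `*` [set v2] `*` [set v3])) => //.
rewrite product_measure1E//; last exact: measurableX.
by rewrite [X in (_ * X)%E](lebesgue_measure_set1 v3) mule0.
Qed.

(** Lets the singular point of the kernel be discarded under integrals. *)
Lemma ae_neq v : {ae mu, forall x, x != v}.
Proof.
exists [set v]; split; last 2 first.
- exact: lebesgue_measure3_set1.
- by move=> x /= /negP; rewrite negbK => /eqP.
have -> : [set v] = ([set v.1.1] `*` [set v.1.2]) `*` [set v.2].
  case: v => [[v1 v2] v3].
  by apply/seteqP; split=> [_ -> //|[[a b] c]/= [[-> ->] ->]].
by apply: measurableX => //; exact: measurableX.
Qed.

End Lebesgue3.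

(** * Measurability of continuous functions of three variables *)

Section ContinuousMeasurable.
Context {R : realType}.
Local Notation V := (space R).

Definition grid (n : nat) (s : R) : R := (Num.floor (n.+1%:R * s))%:~R / n.+1%:R.

Lemma grid_cvg s : grid n s @[n --> \oo] --> s.
Proof.
apply: (@squeeze_cvgr _ _ _ _ (fun n => s - n.+1%:R^-1) (cst s)).
- near=> n; rewrite /grid /=; have n0 : 0 < n.+1%:R :> R by rewrite ltr0n.
  rewrite ler_pdivrMr// ler_pdivlMr// mulrBl mulVf ?gt_eqF// mulrC.
  by rewrite floor_le andbT lerBlDr -intrD1 ltW// floorD1_gt.
- rewrite -[X in _ --> X]subr0; apply: cvgB; first exact: cvg_cst.
  exact: cvg_harmonic.
- exact: cvg_cst.
Unshelve. all: by end_near. Qed.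

Lemma measurable_grid_fiber n (k : int) :
  measurable ([set s : R | Num.floor (n.+1%:R * s) == k] : set (measurableTypeR R)).
Proof.
have m1 : measurable_fun [set: R] (fun s : R => (Num.floor (n.+1%:R * s))%:~R : R).
  apply: nondecreasing_measurable => // s t st.
  by rewrite ler_int le_floor// ler_wpM2l.
have := m1 measurableT _ (measurable_set1 (k%:~R : R)).
rewrite setTI; congr measurable; apply/seteqP; split=> s /=.
  by move=> /eqP; rewrite eqr_int.
by move=> /eqP ->.
Qed.

(* A continuous function is the limit of the functions obtained by rounding
   its argument to finer and finer grids. *)
Lemma continuous_measurable3 (u : R * R * R -> R) :
  continuous u -> measurable_fun [set: V] u.
Proof.
move=> cu.
pose g n (x : R * R * R) := (grid n x.1.1, grid n x.1.2, grid n x.2).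
have gc (x : R * R * R) : u (g n x) @[n --> \oo] --> u x.
  apply: (@cvg_comp _ _ _ (fun n => g n x) u _ (nbhs x)); last exact: cu.
  case: x => x12 x3; apply: (@cvg_pair _ _ _ _ (nbhs x12) (nbhs x3) _ _ _
    (fun n => (grid n x12.1, grid n x12.2)) (grid^~ x3)); last exact: grid_cvg.
  by case: x12 => x1 x2; apply: (@cvg_pair _ _ _ _ (nbhs x1) (nbhs x2) _ _ _
    (grid^~ x1) (grid^~ x2)); exact: grid_cvg.
apply: (@measurable_fun_cvg _ _ _ _ (fun n x => u (g n x))); last first.
  by move=> x _; exact: gc.
move=> n _ Y mY; rewrite setTI.
pose node (k : int * int * int) : R * R * R :=
  (k.1.1%:~R / n.+1%:R, k.1.2%:~R / n.+1%:R, k.2%:~R / n.+1%:R).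
pose box (i : int) := [set s : R | Num.floor (n.+1%:R * s) == i].
(* The rounded function is constant on each grid cell, so the preimage is the countable union of the
   cells whose node is mapped into [Y]. *)
rewrite [X in measurable X](_ : _ = \bigcup_(k : int * int * int)
   if `[< Y (u (node k)) >] then (box k.1.1 `*` box k.1.2) `*` box k.2 else set0).
  apply: (@countable_bigcupT_measurable _ _ (int * int * int)%type) => [|k].
    exact: countableP.
  case: ifP => // _.
  by apply: measurableX; [apply: measurableX|]; exact: measurable_grid_fiber.
apply/seteqP; split => [[[x1 x2] x3] /= Yx|x /= [k _]].
  exists (Num.floor (n.+1%:R * x1), Num.floor (n.+1%:R * x2),
    Num.floor (n.+1%:R * x3)) => //.
  by rewrite (asboolT Yx)/= /box /= !eqxx.
case: asboolP => // Yk [[/eqP b1 /eqP b2] /eqP b3].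
by rewrite /g /grid b1 b2 b3.
Qed.

End ContinuousMeasurable.

(** * The kernel and its derivatives *)

Section Kernel.
Context {R : realType}.
Local Notation V := (space R).
Variable a : R.
Hypothesis a_gt0 : 0 < a.
Implicit Types (x y z v : R * R * R) (s t c : R).

Lemma calK_phi z : calK a z = phi (norm3 z / a) / a.
Proof.
by rewrite /calK /phi invf_div [a / _]mulrC mulrA mulfK// gt_eqF.
Qed.

Lemma norm30 : norm3 (0 : R * R * R) = 0.
Proof.
rewrite -[LHS]/(Num.sqrt ((0 : R) ^+ 2 + 0 ^+ 2 + 0 ^+ 2)).
by rewrite expr0n/= !addr0 sqrtr0.
Qed.

Lemma norm3_gt0 z : z != 0 -> 0 < norm3 z.
Proof.
move=> z0; rewrite lt_neqAle norm3_ge0 andbT eq_sym.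
by apply: contraNneq z0 => /norm3_eq0 ->.
Qed.

Lemma calK_ge0 z : 0 <= calK a z.
Proof.
rewrite calK_phi divr_ge0 ?(ltW a_gt0)// phi_ge0//.
by rewrite divr_ge0 ?norm3_ge0 ?(ltW a_gt0).
Qed.

Lemma calK_gt0 z : z != 0 -> 0 < calK a z.
Proof. by move=> z0; rewrite calK_phi divr_gt0// phi_gt0// divr_gt0// norm3_gt0. Qed.

Lemma calK_le z : calK a z <= a^-1.
Proof.
rewrite calK_phi ler_piMl ?invr_ge0 ?(ltW a_gt0)//.
by rewrite phi_le1// divr_ge0 ?norm3_ge0 ?(ltW a_gt0).
Qed.

(** On nonnegative numbers, 0 included, inversion is the power with exponent -1. *)
Lemma measurable_inv_ge0 (g : V -> R) : (forall x, 0 <= g x) ->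
  measurable_fun [set: V] g -> measurable_fun [set: V] (fun x => (g x)^-1).
Proof.
move=> g0 mg; rewrite (_ : (fun x => _) = (fun x => g x `^ (-1))).
  exact: (measurableT_comp (measurable_powR _)).
by apply/funext => x; rewrite powR_inv1.
Qed.

Lemma measurable_calK : measurable_fun [set: V] (calK a).
Proof.
have mr := @measurable_norm3 R.
apply: measurable_funM.
  apply: measurable_funB => //.
  apply: (measurableT_comp (@measurable_expR R)).
  apply: measurable_funN; apply: measurable_funM => //.
by apply: measurable_inv_ge0 => // x; exact: norm3_ge0.
Qed.

(* Derivative of [calK a] along the axis of [pi]; at the origin, where it does
   not exist, the division by zero gives [0]. *)
Definition dcalK (pi : R * R * R -> R) z : R :=
  - psi (norm3 z / a) * (pi z / norm3 z) / a ^+ 2.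

(** Oddness is what turns the exchange of x and y into differences of truncated coordinates. *)
Lemma dcalKN pi e z : axis pi e -> dcalK pi (- z) = - dcalK pi z.
Proof.
move=> [_ piB _ _ _]; have pi0 : pi 0 = 0 by rewrite -(subrr z) piB subrr.
have piN : pi (- z) = - pi z by rewrite -[- z]add0r piB pi0 add0r.
by rewrite /dcalK norm3N piN; ring.
Qed.

Lemma psi_norm3_ge0 z : 0 <= psi (norm3 z / a).
Proof. by rewrite psi_ge0// divr_ge0 ?norm3_ge0 ?(ltW a_gt0). Qed.

Lemma dcalK_bound pi e z : axis pi e -> `|dcalK pi z| <= a ^- 2.
Proof.
move=> [_ _ _ _ pile].
have a2 : 0 < a ^+ 2 by rewrite exprn_gt0.
rewrite /dcalK !normrM normrN (ger0_norm (psi_norm3_ge0 z)).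
rewrite (@ger0_norm _ (a ^- 2)) ?invr_ge0 ?(ltW a2)//.
have p1 : psi (norm3 z / a) <= 1.
  by rewrite psi_le1// divr_ge0 ?norm3_ge0 ?(ltW a_gt0).
rewrite ler_piMl ?invr_ge0 ?(ltW a2)//.
apply: mulr_ile1; rewrite ?psi_norm3_ge0 ?mulr_ge0//.
have [->|/norm3_gt0 r0] := eqVneq z 0.
  by rewrite norm30 invr0 normr0 mulr0.
by rewrite normfV ler_pdivrMr ?normr_gt0 ?gt_eqF// mul1r (ger0_norm (ltW r0)).
Qed.

Lemma measurable_dcalK pi e : axis pi e -> measurable_fun [set: V] (dcalK pi).
Proof.
move=> [mpi _ _ _ _]; have mr := @measurable_norm3 R.
have ms : measurable_fun [set: V] (fun z => norm3 z / a).
  by apply: measurable_funM.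
have mE : measurable_fun [set: V] (fun z => expR (- (norm3 z / a))).
  apply: (measurableT_comp (@measurable_expR R)); exact: measurable_funN.
apply: measurable_funM => //; apply: measurable_funM; last first.
  apply: measurable_funM => //.
  by apply: measurable_inv_ge0 => // x; exact: norm3_ge0.
apply: measurable_funN; apply: measurable_funM.
  apply: measurable_funB; first by apply: measurable_funB.
  exact: measurable_funM.
apply: measurable_inv_ge0 => [x|]; first exact: sqr_ge0.
exact: measurable_funX.
Qed.

(** Both points must avoid the origin: [calK] is 0 there by convention and the bound can fail. *)
Lemma calK_shift_bound pi e z t : axis pi e -> z != 0 -> z + e t != 0 ->
  `|calK a (z + e t) - calK a z| <= 2 / a * `|t| * calK a z.
Proof.
move=> ax z0 z1; rewrite !calK_phi -mulrBl normrM.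
rewrite (@ger0_norm _ a^-1) ?invr_ge0 ?(ltW a_gt0)//.
rewrite [leRHS]mulrA ler_pM2r ?invr_gt0//.
apply: le_trans (phi_lip _ _) _; rewrite ?divr_gt0 ?norm3_gt0//.
rewrite ler_wpM2r ?phi_ge0 ?divr_ge0 ?norm3_ge0 ?(ltW a_gt0)//.
rewrite -mulrBl normrM (@ger0_norm _ a^-1) ?invr_ge0 ?(ltW a_gt0)//.
have h := axis_norm3_lip ax z t.
rewrite -!mulrA ler_pM2l// mulrC ler_pM2l ?invr_gt0//.
Qed.

(** Difference quotients are taken along this sequence, so that dominated convergence applies. Its
    values lie in ]0, 1], as [tent_clip] requires. *)
Definition step (n : nat) : R := n.+1%:R^-1.

Lemma step_gt0 n : 0 < step n. Proof. by rewrite invr_gt0 ltr0n. Qed.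

Lemma step_cvg : step n @[n --> \oo] --> (0 : R).
Proof. exact: cvg_harmonic. Qed.

(** The squared norm is quadratic in the step; the chain rule then passes through the square root,
    the scaling by [a] and [phi]. *)
Lemma calK_derivative pi e z : axis pi e -> z != 0 ->
  (calK a (z + e (step n)) - calK a z) / step n @[n --> \oo] --> dcalK pi z.
Proof.
move=> [_ _ _ nE _] z0; have r0 := norm3_gt0 z0.
have r20 : 0 < norm3 z ^+ 2 by rewrite exprn_gt0.
have c1 : (norm3 (z + e (step n)) ^+ 2 - norm3 z ^+ 2) / step n @[n --> \oo]
    --> 2 * pi z.
  rewrite (_ : (fun n => _) = (fun n => 2 * pi z + step n)); last first.
    apply/funext => n; rewrite nE; field; by rewrite gt_eqF ?step_gt0.
  by rewrite -[X in _ --> X]addr0; apply: cvgD; [exact: cvg_cst|exact: step_cvg].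
have sq : norm3 (z + e (step n)) ^+ 2 @[n --> \oo] --> norm3 z ^+ 2.
  rewrite (_ : (fun n => _) =
      (fun n => norm3 z ^+ 2 + 2 * step n * pi z + step n * step n)); last first.
    by apply/funext => n; rewrite nE -expr2.
  have H : norm3 z ^+ 2 + 2 * step n * pi z + step n * step n @[n --> \oo] -->
      norm3 z ^+ 2 + 2 * 0 * pi z + 0 * 0.
    have sc := step_cvg; apply: cvgD; last exact: cvgM.
    apply: cvgD; first exact: cvg_cst.
    by apply: cvgM; [apply: cvgM => //; exact: cvg_cst|exact: cvg_cst].
  by move: H; rewrite mulr0 !mul0r !addr0.
have c2 := diff_quotient_cvg (is_derive1_sqrt r20) sq c1.
have nK x : Num.sqrt (norm3 x ^+ 2) = norm3 x.
  by rewrite sqrtr_sqr ger0_norm ?norm3_ge0.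
have c3 : (norm3 (z + e (step n)) / a - norm3 z / a) / step n @[n --> \oo]
    --> pi z / norm3 z / a.
  rewrite (_ : (fun n => _) = (fun n => (Num.sqrt (norm3 (z + e (step n)) ^+ 2) -
    Num.sqrt (norm3 z ^+ 2)) / step n / a)); last first.
    by apply/funext => n; rewrite !nK -mulrBl mulrAC.
  rewrite (_ : pi z / norm3 z / a =
    (2 * Num.sqrt (norm3 z ^+ 2))^-1 * (2 * pi z) / a); last first.
    by rewrite nK; field; rewrite !gt_eqF.
  by apply: cvgM; [exact: c2|exact: cvg_cst].
have nc : norm3 (z + e (step n)) / a @[n --> \oo] --> norm3 z / a.
  apply: cvgM; last exact: cvg_cst.
  have H : Num.sqrt (norm3 (z + e (step n)) ^+ 2) @[n --> \oo] -->
      Num.sqrt (norm3 z ^+ 2).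
    apply: (@cvg_comp _ _ _ _ (@Num.sqrt R) _ (nbhs (norm3 z ^+ 2))) => //.
    exact: sqrt_continuous.
  by move: H; under eq_fun do rewrite nK; rewrite nK.
have s0 : 0 < norm3 z / a by rewrite divr_gt0.
have c4 := diff_quotient_cvg (is_derive_phi s0) nc c3.
rewrite (_ : (fun n => _) = (fun n => (phi (norm3 (z + e (step n)) / a) -
  phi (norm3 z / a)) / step n / a)); last first.
  by apply/funext => n; rewrite !calK_phi -mulrBl mulrAC.
rewrite (_ : dcalK pi z =
  - psi (norm3 z / a) * (pi z / norm3 z / a) / a); last first.
  by rewrite /dcalK; field; rewrite !gt_eqF.
by apply: cvgM; [exact: c4|exact: cvg_cst].
Qed.

(** * Truncation of the dilation field *)

Definition clip (N : R) s : R := Num.max (- N) (Num.min N s).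

Lemma clip_bound N s : 0 <= N -> `|clip N s| <= N.
Proof.
by move=> N0; rewrite ler_norml /clip le_max lexx/= ge_max ge_min lexx/= andbT; lra.
Qed.

Lemma measurable_clip N : measurable_fun [set: R] (clip N).
Proof. by apply: measurable_maxr => //; exact: measurable_minr. Qed.

Lemma clip_lip N s t : 0 <= N -> s <= t -> 0 <= clip N t - clip N s <= t - s.
Proof.
move=> N0 st; rewrite /clip.
case: (leP N s) => ?; case: (leP N t) => ?;
  case: (leP (- N) N) => ?; case: (leP (- N) s) => ?;
  case: (leP (- N) t) => ?; apply/andP; split; lra.
Qed.

(** For the untruncated field the product would equal the square; the upper bound preserves the
    inequality on the kernel. *)
Lemma clip_mono N s t : 0 <= N ->
  0 <= (clip N s - clip N t) * (s - t) <= (s - t) ^+ 2.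
Proof.
move=> N0; have [st|/ltW ts] := leP s t.
  have /andP[h1 h2] := clip_lip N0 st.
  have d0 : 0 <= t - s by rewrite subr_ge0.
  by rewrite -mulrNN !opprB -sqrrN opprB expr2 mulr_ge0//= ler_wpM2r.
have /andP[h1 h2] := clip_lip N0 ts.
have d0 : 0 <= s - t by rewrite subr_ge0.
by rewrite expr2 mulr_ge0//= ler_wpM2r.
Qed.

(** A cutoff that tends to 1 as [N] grows and bounds from below the difference quotients of the
    truncated coordinates. *)
Definition tent (N : R) z := Num.max 0 (1 - norm3 z / N).

Lemma tent_01 N z : 0 < N -> 0 <= tent N z <= 1.
Proof.
move=> N0; rewrite /tent le_max lexx/= ge_max ler01 gerBl.
by rewrite divr_ge0 ?norm3_ge0 ?ltW.
Qed.

Lemma measurable_tent N : measurable_fun [set: V] (tent N).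
Proof.
apply: measurable_maxr => //; apply: measurable_funB => //.
by apply: measurable_funM => //; exact: measurable_norm3.
Qed.

Lemma tent_cvg z : tent n.+1%:R z @[n --> \oo] --> (1 : R).
Proof.
apply: (@squeeze_cvgr _ _ _ _ (fun n => 1 - norm3 z * step n) (cst 1)).
- apply: nearW => n; have /andP[_ ->] := tent_01 z (ltr0Sn R n).
  by rewrite andbT /tent le_max lexx orbT.
- have H : 1 - norm3 z * step n @[n --> \oo] --> 1 - norm3 z * 0.
    apply: cvgB; first exact: cvg_cst.
    by apply: cvgM; [exact: cvg_cst|exact: step_cvg].
  by move: H; rewrite mulr0 subr0.
- exact: cvg_cst.
Qed.

(* Inside the ball of radius [N], off which [tent N] vanishes, the function
   [clip (N + 1)] is the identity, also after a shift by at most [1]. *)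
Lemma tent_clip pi e N z t : axis pi e -> 0 < N -> 0 <= t <= 1 ->
  tent N z * t <= clip (N + 1) (pi z) - clip (N + 1) (pi z - t).
Proof.
move=> [_ _ _ _ pile] N0 /andP[t0 t1].
have /andP[T0 T1] := tent_01 z N0.
have [h|h] := leP N (norm3 z).
  have -> : tent N z = 0.
    by apply/max_idPl; rewrite subr_le0 ler_pdivlMr// mul1r.
  have N1 : 0 <= N + 1 by lra.
  have pt : pi z - t <= pi z by rewrite gerBl.
  by rewrite mul0r; have /andP[] := clip_lip N1 pt.
have := le_lt_trans (pile z) h; rewrite ltr_norml => /andP[h1 h2].
have cE s : - (N + 1) <= s <= N + 1 -> clip (N + 1) s = s.
  by move=> /andP[s1 s2]; rewrite /clip min_r// max_r.
rewrite !cE; try lra.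
by rewrite opprB addrC subrK ler_piMl.
Qed.

(** Truncated form of z.grad K(z) >= - K(z). The right-hand side is a nonpositive radial factor
    times [S]; replacing [S] by its upper bound [norm3 z ^+ 2] leaves the inequality
    [psi_le_phi]. *)
Lemma sum_dcalK (p1 p2 p3 : R * R * R -> R) e1 e2 e3 N x y :
  0 <= N -> axis p1 e1 -> axis p2 e2 -> axis p3 e3 ->
  (forall z, norm3 z ^+ 2 = p1 z ^+ 2 + p2 z ^+ 2 + p3 z ^+ 2) ->
  - calK a (x - y) <=
  (clip N (p1 x) - clip N (p1 y)) * dcalK p1 (x - y) +
  (clip N (p2 x) - clip N (p2 y)) * dcalK p2 (x - y) +
  (clip N (p3 x) - clip N (p3 y)) * dcalK p3 (x - y).
Proof.
move=> N0 [_ B1 _ _ _] [_ B2 _ _ _] [_ B3 _ _ _] nE.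
set z := x - y.
have /andP[_ c1] := clip_mono (p1 x) (p1 y) N0.
have /andP[_ c2] := clip_mono (p2 x) (p2 y) N0.
have /andP[_ c3] := clip_mono (p3 x) (p3 y) N0.
have zE := nE z.
rewrite -!(B1, B2, B3) -/z in c1 c2 c3.
have [z0|z0] := eqVneq z 0.
  rewrite z0 /dcalK norm30 invr0 !mulr0 !mul0r !mulr0 !addr0.
  by rewrite oppr_le0 calK_ge0.
have r0 := norm3_gt0 z0.
pose S := (clip N (p1 x) - clip N (p1 y)) * p1 z +
  (clip N (p2 x) - clip N (p2 y)) * p2 z +
  (clip N (p3 x) - clip N (p3 y)) * p3 z.
have Sle : S <= norm3 z ^+ 2 by rewrite zE; apply: lerD => //; exact: lerD.
rewrite [leRHS](_ : _ = - (psi (norm3 z / a) / (norm3 z * a ^+ 2) * S)); last first.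
  by rewrite /dcalK /S; field; rewrite !gt_eqF.
rewrite lerN2.
have s0 : 0 < norm3 z / a by rewrite divr_gt0.
apply: le_trans (_ : psi (norm3 z / a) * (norm3 z / a) / a <= _); last first.
  by rewrite calK_phi ler_pM2r ?invr_gt0// psi_le_phi.
rewrite [leRHS](_ : _ =
  psi (norm3 z / a) / (norm3 z * a ^+ 2) * norm3 z ^+ 2); last first.
  by field; rewrite !gt_eqF.
rewrite ler_wpM2l// divr_ge0 ?psi_norm3_ge0// mulr_ge0 ?(ltW r0)//.
exact: sqr_ge0.
Qed.

End Kernel.

(** * Real-valued integrals and bilinear forms *)

Section RealIntegral.
Context d (T : measurableType d) {R : realType}.
Variable mu : {measure set T -> \bar R}.
Implicit Types (f g h : T -> R).

Lemma integrable_le g h : measurable_fun [set: T] g ->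
  (forall x, `|g x| <= h x) -> mu.-integrable setT (EFin \o h) ->
  mu.-integrable setT (EFin \o g).
Proof.
move=> mg gh; apply: le_integrable => //; first exact/measurable_EFinP.
by move=> x _; rewrite /= lee_fin (le_trans (gh x))// ler_norm.
Qed.

Lemma integrable_measurable g : mu.-integrable setT (EFin \o g) ->
  measurable_fun [set: T] g.
Proof. by move=> /integrableP[/measurable_EFinP]. Qed.

Lemma integrable_scale c g : mu.-integrable setT (EFin \o g) ->
  mu.-integrable setT (EFin \o (fun x => c * g x)).
Proof. by move=> ig; exact: (integrableZl measurableT c ig). Qed.

Lemma ge0_fin_integrable g : measurable_fun [set: T] g -> (forall x, 0 <= g x) ->
  (\int[mu]_x (g x)%:E < +oo)%E -> mu.-integrable setT (EFin \o g).
Proof.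
move=> mg g0 gy; apply/integrableP; split; first exact/measurable_EFinP.
under eq_integral do rewrite /= ger0_norm//.
exact: gy.
Qed.

Lemma EFin_Rintegral g : mu.-integrable setT (EFin \o g) ->
  ((\int[mu]_x g x)%:E = \int[mu]_x (g x)%:E)%E.
Proof. by move=> ig; rewrite /Rintegral fineK//; exact: integrable_fin_num. Qed.

Lemma Rintegral_dominated_cvg (g_ : nat -> T -> R) g h :
  (forall n, measurable_fun [set: T] (g_ n)) -> measurable_fun [set: T] g ->
  {ae mu, forall x, g_ ^~ x @ \oo --> g x} ->
  mu.-integrable setT (EFin \o h) ->
  {ae mu, forall x n, `|g_ n x| <= h x} ->
  mu.-integrable setT (EFin \o g) /\
  \int[mu]_x g_ n x @[n --> \oo] --> \int[mu]_x g x.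
Proof.
move=> mg_ mg cg ih gh.
have cg' : {ae mu, forall x, setT x -> (g_ n x)%:E @[n --> \oo] --> (g x)%:E}.
  apply: filterS cg => x gx _.
  by apply: cvg_EFin; [exact: nearW|exact: gx].
have gh' : {ae mu, forall x n, setT x -> (`|(g_ n x)%:E| <= (h x)%:E)%E}.
  by apply: filterS gh => x gx n _; rewrite lee_fin.
have [ig _ H] := dominated_convergence measurableT
  (fun n => (measurable_EFinP _ _).2 (mg_ n)) ((measurable_EFinP _ _).2 mg)
  cg' ih gh'.
split=> //; apply: fine_cvg; rewrite EFin_Rintegral//; exact: H.
Qed.

Lemma ae_ge0_le_Rintegral g h : (forall x, 0 <= g x) -> (forall x, 0 <= h x) ->
  mu.-integrable setT (EFin \o g) -> mu.-integrable setT (EFin \o h) ->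
  {ae mu, forall x, g x <= h x} -> \int[mu]_x g x <= \int[mu]_x h x.
Proof.
move=> g0 h0 ig ih gh; rewrite -lee_fin !EFin_Rintegral//.
have mg := integrable_measurable ig; have mh := integrable_measurable ih.
apply: ae_ge0_le_integral => //.
- by move=> x _; rewrite lee_fin.
- exact/measurable_EFinP.
- by move=> x _; rewrite lee_fin.
- exact/measurable_EFinP.
- by apply: filterS gh => x gh _; rewrite lee_fin.
Qed.

End RealIntegral.

(** * Double integrals of a bounded kernel against an integrable density *)

Section Bilinear.
Context d (T : measurableType d) {R : realType}.
Variable mu : {sigma_finite_measure set T -> \bar R}.
Variable f : T -> R.
Hypothesis f0 : forall x, 0 <= f x.
Hypothesis fint : mu.-integrable setT (EFin \o f).
Implicit Types (g h : T * T -> R).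

(** An iterated integral, because the inner one is how the integral equation enters; [bilinE]
    identifies it with the integral over the product. *)
Definition bilin g : R := \int[mu]_x (f x * \int[mu]_y (g (x, y) * f y)).

Definition bounded_kernel g :=
  measurable_fun [set: T * T] g /\ exists c, forall p, `|g p| <= c.

Let mf : measurable_fun [set: T] f := integrable_measurable fint.

Lemma bilin_inner g : bounded_kernel g ->
  forall x, mu.-integrable setT (EFin \o (fun y => g (x, y) * f y)).
Proof.
move=> [mg [c gc]] x; apply: (integrable_le _ _ (integrable_scale c fint)).
  by apply: measurable_funM => //; exact: (measurableT_comp mg (pair1_measurable x)).
by move=> y; rewrite normrM (ger0_norm (f0 y)) ler_wpM2r.
Qed.

Let dens g (p : T * T) := g p * (f p.1 * f p.2).

(** By Tonelli the product f(x) f(y) is integrable, its integral being the square of that of [f]; a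
    bounded factor preserves this. *)
Lemma integrable_dens g : bounded_kernel g ->
  (mu \x mu)%E.-integrable setT (EFin \o dens g).
Proof.
move=> [mg [c gc]].
have mff : measurable_fun [set: T * T] (fun p : T * T => f p.1 * f p.2).
  by apply: measurable_funM; apply: (measurableT_comp mf).
have iff : (mu \x mu)%E.-integrable setT (EFin \o (fun p : T * T => f p.1 * f p.2)).
  apply/integrable12ltyP; first exact/measurable_EFinP.
  have E x : (\int[mu]_y `|(EFin \o (fun p : T * T => (f p.1 * f p.2)%R)) (x, y)| =
      (f x)%:E * (\int[mu]_y f y)%:E)%E.
    rewrite EFin_Rintegral// -ge0_integralZl_EFin//.
    - apply: eq_integral => y _ /=; rewrite ger0_norm ?mulr_ge0// EFinM //.
    - by move=> y _; rewrite lee_fin.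
    - exact/measurable_EFinP.
  under eq_integral do rewrite E.
  have i2 := integrableZr measurableT (\int[mu]_y f y)%R fint.
  exact: (integrable_lty measurableT i2).
apply: (integrable_le _ _ (integrable_scale c iff)).
  exact: measurable_funM.
by move=> p; rewrite normrM [`|f _ * _|]ger0_norm ?mulr_ge0// ler_wpM2r// mulr_ge0.
Qed.

Lemma bilinE g : bounded_kernel g ->
  (bilin g)%:E = (\int[(mu \x mu)%E]_p (dens g p)%:E)%E.
Proof.
move=> bg; have ig := integrable_dens bg.
rewrite -(integral12_prod_meas1 ig) /bilin.
have E x : fubini_F mu (EFin \o dens g) x =
    (f x * \int[mu]_y (g (x, y) * f y))%:E.
  rewrite EFinM EFin_Rintegral; last exact: bilin_inner.
  rewrite -integralZl//; last exact: bilin_inner.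
  by apply: eq_integral => y _; rewrite /= -EFinM /dens/=; congr (_%:E); ring.
under eq_integral do rewrite E.
rewrite EFin_Rintegral//.
have := integrable_fubini_F ig.
by apply: eq_integrable => // x _; rewrite E.
Qed.

Lemma bilin_Rint g : bounded_kernel g ->
  bilin g = \int[(mu \x mu)%E]_p dens g p.
Proof.
move=> bg; apply: EFin_inj; rewrite bilinE// EFin_Rintegral//.
exact: integrable_dens.
Qed.

Lemma bounded_kernel_swap g : bounded_kernel g ->
  bounded_kernel (fun p => g (p.2, p.1)).
Proof.
move=> [mg [c gc]]; split; last by exists c => p; exact: gc.
by apply: (measurableT_comp mg); exact: measurable_fun_pair.
Qed.

Lemma bilin_swap g : bounded_kernel g -> bilin (fun p => g (p.2, p.1)) = bilin g.
Proof.
move=> bg; apply: EFin_inj; rewrite !bilinE//; last exact: bounded_kernel_swap.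
rewrite -(integral21_prod_meas1 (integrable_dens bg)).
rewrite -(integral12_prod_meas1 (integrable_dens (bounded_kernel_swap bg))).
apply: eq_integral => x _; apply: eq_integral => y _ /=.
by rewrite /dens/= [f x * _]mulrC.
Qed.

Lemma bounded_kernelD g h : bounded_kernel g -> bounded_kernel h ->
  bounded_kernel (fun p => g p + h p).
Proof.
move=> [mg [c gc]] [mh [c' hc]]; split; first exact: measurable_funD.
by exists (c + c') => p; rewrite (le_trans (ler_normD _ _))// lerD.
Qed.

Lemma bilinD g h : bounded_kernel g -> bounded_kernel h ->
  bilin (fun p => g p + h p) = bilin g + bilin h.
Proof.
move=> bg bh; rewrite !bilin_Rint//; last exact: bounded_kernelD.
rewrite -RintegralD//; [|exact: integrable_dens|exact: integrable_dens].
by apply: eq_Rintegral => p _; rewrite /dens mulrDl.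
Qed.

Lemma bilin_ge0 g : (forall p, 0 <= g p) -> 0 <= bilin g.
Proof.
move=> g0; apply: Rintegral_ge0 => x _; rewrite mulr_ge0//.
by apply: Rintegral_ge0 => y _; rewrite mulr_ge0.
Qed.

End Bilinear.

(** * The Pohozaev inequality for positive solutions *)

Section Pohozaev.
Context {R : realType}.
Local Notation V := (space R).
Local Notation mu := (@lebesgue3 R).
Variables (a C q : R) (u : R * R * R -> R).
Hypotheses (a_gt0 : 0 < a) (C_gt0 : 0 < C) (q_gt1 : 1 < q).
Hypothesis mu_u : measurable_fun [set: V] u.
Hypothesis u_01 : forall x, 0 < u x <= 1.
Hypothesis u_pow : mu.-integrable setT (EFin \o (fun x => u x `^ (q - 1))).
Hypothesis u_sol : forall x,
  u x = C * \int[mu]_y (calK a (x - y) * nonlin q (u y)).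
Implicit Types x y z : R * R * R.

Let f y := nonlin q (u y).

Let u_ge0 x : 0 <= u x <= 1.
Proof. by have /andP[/ltW -> ->] := u_01 x. Qed.

Let ae_filter : Filter (nbhs (almost_everywhere mu)).
Proof. exact: (@ae_filter_ringOfSetsType _ V R (@lebesgue_measure3 R)). Qed.

Lemma nonlin_u_ge0 x : 0 <= f x.
Proof. by have /andP[] := nonlin_01 q_gt1 (u_ge0 x). Qed.

Lemma measurable_nonlin_u : measurable_fun [set: V] f.
Proof.
apply: measurable_funM; first exact: (measurableT_comp (measurable_powR _)).
apply: measurable_funB => //; exact: (measurableT_comp (measurable_powR _)).
Qed.

Lemma integrable_nonlin_u : mu.-integrable setT (EFin \o f).
Proof.
apply: (integrable_le measurable_nonlin_u _ u_pow) => x.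
by have /andP[h1 h2] := nonlin_01 q_gt1 (u_ge0 x); rewrite ger0_norm.
Qed.

Let bounded_calK : bounded_kernel (fun p : V * V => calK a (p.1 - p.2)).
Proof.
split; first exact: (measurableT_comp (measurable_calK a) measurable_subr).
by exists a^-1 => p; rewrite ger0_norm ?calK_ge0// calK_le.
Qed.

Let bounded_dcalK pi e : axis pi e ->
  bounded_kernel (fun p : V * V => dcalK a pi (p.1 - p.2)).
Proof.
move=> ax; split.
  exact: (measurableT_comp (measurable_dcalK a ax) measurable_subr).
by exists (a ^- 2) => p; exact: (dcalK_bound a_gt0 _ ax).
Qed.

Let integrable_calK x :
  mu.-integrable setT (EFin \o (fun y => calK a (x - y) * f y)).
Proof.
exact: (@bilin_inner _ _ _ mu f nonlin_u_ge0 integrable_nonlin_u _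
  bounded_calK x).
Qed.

Let integrable_dcalK pi e : axis pi e -> forall x,
  mu.-integrable setT (EFin \o (fun y => dcalK a pi (x - y) * f y)).
Proof.
move=> ax x; exact: (@bilin_inner _ _ _ mu f nonlin_u_ge0 integrable_nonlin_u _
  (bounded_dcalK ax) x).
Qed.

Let shiftE pi e : axis pi e -> forall x t,
  u (x + e t) - u x =
  C * \int[mu]_y ((calK a (x - y + e t) - calK a (x - y)) * f y).
Proof.
move=> ax x t; rewrite !u_sol -mulrBr -RintegralB//.
congr (_ * _); apply: eq_Rintegral => y _.
by rewrite mulrBl [x + e t - y]addrAC.
Qed.

Let integrable_shift pi e : axis pi e -> forall x t,
  mu.-integrable setT
    (EFin \o (fun y => (calK a (x - y + e t) - calK a (x - y)) * f y)).
Proof.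
move=> ax x t.
have := integrableB measurableT (integrable_calK (x + e t)) (integrable_calK x).
by apply: eq_integrable => // y _ /=; rewrite -EFinB mulrBl [x + e t - y]addrAC.
Qed.

(** The two excluded points [y = x] and [y = x + e t] are those where an argument of the kernel
    vanishes. *)
Let ae_shift_bound pi e : axis pi e -> forall x t,
  {ae mu, forall y, `|(calK a (x - y + e t) - calK a (x - y)) * f y| <=
     2 / a * `|t| * (calK a (x - y) * f y)}.
Proof.
move=> ax x t; have FF := ae_filter.
have n1 : {ae mu, forall y, y != x} := ae_neq x.
have n2 : {ae mu, forall y, y != x + e t} := ae_neq (x + e t).
apply: filterS2 n1 n2 => y yx yxt.
rewrite normrM (ger0_norm (nonlin_u_ge0 y)) [leRHS]mulrA ler_wpM2r ?nonlin_u_ge0//.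
apply: (calK_shift_bound a_gt0 ax); first by rewrite subr_eq0 eq_sym.
by rewrite addrAC subr_eq0 eq_sym.
Qed.

(** The kernel bound is a multiple of the kernel itself, so integration against [C * f] reproduces
    [u] on the right. *)
Let u_shift_bound pi e : axis pi e -> forall x t,
  `|u (x + e t) - u x| <= 2 / a * `|t| * u x.
Proof.
move=> ax x t; rewrite (shiftE ax) normrM (gtr0_norm C_gt0).
rewrite [in leRHS]u_sol [leRHS]mulrCA ler_pM2l//.
apply: le_trans (le_normr_Rintegral measurableT (integrable_shift ax x t)) _.
rewrite -(RintegralZl _ measurableT (integrable_calK x)).
apply: ae_ge0_le_Rintegral.
- by move=> y.
- move=> y; apply: mulr_ge0; first by rewrite mulr_ge0// divr_ge0// ltW.
  by apply: mulr_ge0; [exact: calK_ge0|exact: nonlin_u_ge0].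
- exact: (integrable_norm (integrable_shift ax x t)).
- exact: integrable_scale (integrable_calK x).
- exact: (ae_shift_bound ax x t).
Qed.

(** The partial derivative of [u], written by differentiating under the integral sign; [du_cvg]
    justifies this by dominated convergence. *)
Let du pi x := C * \int[mu]_y (dcalK a pi (x - y) * f y).

Let du_cvg pi e : axis pi e -> forall x,
  (u (x + e (step n)) - u x) / step n @[n --> \oo] --> du pi x.
Proof.
move=> ax x; have FF := ae_filter.
pose g n y := (calK a (x - y + e (step n)) - calK a (x - y)) * f y / step n.
rewrite (_ : (fun n => _) = (fun n => C * \int[mu]_y g n y)); last first.
  apply/funext => n; rewrite (shiftE ax).
  by rewrite (RintegralZr _ measurableT (integrable_shift ax x (step n))) mulrA.
apply: cvgM; first exact: cvg_cst.
have mI := integrable_measurable (integrable_shift ax x _).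
have [] := @Rintegral_dominated_cvg _ V R mu g
  (fun y => dcalK a pi (x - y) * f y) (fun y => 2 / a * (calK a (x - y) * f y)).
- by move=> n; apply: measurable_funM => //; exact: mI.
- exact: integrable_measurable (integrable_dcalK ax x).
- have n1 : {ae mu, forall y, y != x} := ae_neq x.
  apply: filterS n1 => y yx.
  rewrite (_ : g ^~ y = fun n =>
    (calK a (x - y + e (step n)) - calK a (x - y)) / step n * f y); last first.
    by apply/funext => n; rewrite /g mulrAC.
  apply: cvgM; last exact: cvg_cst.
  by apply: (calK_derivative a_gt0 ax); rewrite subr_eq0 eq_sym.
- exact: integrable_scale (integrable_calK x).
- apply/ae_foralln => n; apply: filterS (ae_shift_bound ax x (step n)) => y.
  have s0 := @step_gt0 R n; rewrite (gtr0_norm s0) => h.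
  rewrite /g normrM normfV (gtr0_norm s0) ler_pdivrMr//.
  by apply: le_trans h _; rewrite mulrAC.
- by [].
Qed.

Let integrable_uf : mu.-integrable setT (EFin \o (fun x => u x * f x)).
Proof.
apply: (integrable_le _ _ integrable_nonlin_u).
  by apply: measurable_funM => //; exact: measurable_nonlin_u.
move=> x; have /andP[u0 u1] := u_ge0 x; have f0 := nonlin_u_ge0 x.
have uf0 : 0 <= u x * f x by exact: mulr_ge0.
by rewrite (ger0_norm uf0); exact: ler_piMl.
Qed.

Let F x := primitive q (u x).

Let measurable_F : measurable_fun [set: V] F.
Proof.
apply: measurable_funB; (apply: measurable_funM; last by []);
  exact: (measurableT_comp (measurable_powR _)).
Qed.

Let F_ge0 x : 0 <= F x.
Proof. by have /andP[] := primitive_01 q_gt1 (u_01 x). Qed.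

Let integrable_F : mu.-integrable setT (EFin \o F).
Proof.
apply: (integrable_le measurable_F _ u_pow) => x.
by have /andP[h1 h2] := primitive_01 q_gt1 (u_01 x); rewrite ger0_norm.
Qed.

Let integrable_boundedM (g h : V -> R) c : measurable_fun [set: V] g ->
  (forall x, `|g x| <= c) -> mu.-integrable setT (EFin \o h) ->
  mu.-integrable setT (EFin \o (fun x => g x * h x)).
Proof.
move=> mg gc ih.
apply: (integrable_le _ _ (integrable_scale c (integrable_norm ih))).
  by apply: measurable_funM => //; exact: (integrable_measurable ih).
by move=> x /=; rewrite normrM ler_wpM2r.
Qed.

Let measurable_u_shift v : measurable_fun [set: V] (fun x => u (x + v)).
Proof. exact: (measurableT_comp mu_u (measurable_addr v)). Qed.

Let measurable_clip_axis pi e : axis pi e -> forall N t,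
  measurable_fun [set: V] (fun x => clip N (pi x - t)).
Proof.
move=> [mpi _ _ _ _] N t.
by apply: (measurableT_comp (measurable_clip N)); exact: measurable_funB.
Qed.

(** Since [pi x = pi (x + e t) - t], the term with [F (x + e t)] is a translate of the integral of
    [clip N (pi x - t) * F x]. *)
Let summation_by_parts pi e : axis pi e -> forall N t, 0 <= N ->
  \int[mu]_x (clip N (pi x) * (F (x + e t) - F x)) =
  - \int[mu]_x ((clip N (pi x) - clip N (pi x - t)) * F x).
Proof.
move=> ax N t N0; have [_ _ piD _ _] := ax.
have ic s : mu.-integrable setT (EFin \o (fun x => clip N (pi x - s) * F x)).
  apply: (integrable_boundedM (c := N)) => //.
    exact: (measurable_clip_axis ax).
  by move=> x; exact: clip_bound.
have i0 : mu.-integrable setT (EFin \o (fun x => clip N (pi x) * F x)).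
  by apply: eq_integrable (ic 0) => // x _; rewrite /= subr0.
have [ish sE] := Rintegral_shift (e t) (ic t).
have E : (fun x => clip N (pi (x + e t) - t) * F (x + e t)) =
    (fun x => clip N (pi x) * F (x + e t)).
  by apply/funext => x; rewrite piD addrK.
rewrite E in ish sE.
under eq_Rintegral do rewrite mulrBr.
rewrite (RintegralB measurableT ish i0) sE.
under [X in _ = - X]eq_Rintegral do rewrite mulrBl.
by rewrite (RintegralB measurableT i0 (ic t)) opprB.
Qed.

(** Integration by parts for the truncated coordinate times the derivative of F(u), which is f(u)
    times [du]. The derivative falling on the truncation is at least [tent N], and F(u) is
    nonnegative. *)
Lemma axis_pohozaev pi e N : axis pi e -> 0 < N ->
  mu.-integrable setT (EFin \o (fun x => f x * (clip (N + 1) (pi x) * du pi x))) /\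
  \int[mu]_x (tent N x * F x) <=
  - \int[mu]_x (f x * (clip (N + 1) (pi x) * du pi x)).
Proof.
move=> ax N0; have [mpi _ _ _ _] := ax.
have N1 : 0 <= N + 1 by lra.
have FF := ae_filter.
have q1 := q_gt1.
pose g n x := clip (N + 1) (pi x) * ((F (x + e (step n)) - F x) / step n).
have mF n : measurable_fun [set: V] (fun x => F (x + e (step n))).
  exact: (measurableT_comp measurable_F (measurable_addr (e (step n)))).
have mc : measurable_fun [set: V] (fun x => clip (N + 1) (pi x)).
  exact: (measurableT_comp (measurable_clip _) mpi).
have mg n : measurable_fun [set: V] (g n).
  apply: measurable_funM => //; apply: measurable_funM => //.
  by apply: measurable_funB => //; exact: mF.
have mdu : measurable_fun [set: V] (du pi).
  apply: (@measurable_fun_cvg _ V R setT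
    (fun n x => (u (x + e (step n)) - u x) / step n)).
    move=> n; apply: measurable_funM => //.
    by apply: measurable_funB => //; exact: measurable_u_shift.
  by move=> x _; exact: (du_cvg ax).
have sb x n : `|u (x + e (step n)) - u x| <= 2 / a * step n * u x.
  by have := u_shift_bound ax x (step n); rewrite (gtr0_norm (@step_gt0 R n)).
have a0 : 0 <= 2 / a by rewrite divr_ge0// ltW.
have ucvg x : u (x + e (step n)) @[n --> \oo] --> u x.
  rewrite (_ : (fun n => _) = (fun n =>
      u x + step n * ((u (x + e (step n)) - u x) / step n))); last first.
    apply/funext => n; rewrite [step n * _]mulrC divfK ?gt_eqF ?step_gt0//.
    by rewrite [RHS]addrC subrK.
  have H : u x + step n * ((u (x + e (step n)) - u x) / step n) @[n --> \oo]
      --> u x + 0 * du pi x.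
    apply: cvgD; first exact: cvg_cst.
    by apply: cvgM; [exact: step_cvg|exact: (du_cvg ax)].
  by move: H; rewrite mul0r addr0.
have gcvg x : g n x @[n --> \oo] --> f x * (clip (N + 1) (pi x) * du pi x).
  rewrite mulrCA; apply: cvgM; first exact: cvg_cst.
  have q0 : 0 < q := lt_trans ltr01 q_gt1.
  have /andP[ux0 _] := u_01 x.
  exact: (diff_quotient_cvg (is_derive_primitive q0 ux0) (ucvg x)
    (@du_cvg _ _ ax x)).
(* The factors bound, in order, the truncated coordinate, the growth of [u] under a shift of length
   at most 1 (raised to the power [q - 1]), and the difference quotient of [u], as [u <= 1]. *)
pose M := (N + 1) * ((1 + 2 / a) `^ (q - 1) * (2 / a)).
have gM x n : `|g n x| <= M * u x `^ (q - 1).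
  have s0 := @step_gt0 R n.
  have s1 : step n <= 1 :> R by rewrite invf_le1 ?ltr0n// ler1n.
  have /andP[ux0 ux1] := u_01 x.
  rewrite normrM -mulrA ler_pM ?clip_bound//.
  rewrite normrM normfV (gtr0_norm s0) ler_pdivrMr//.
  apply: le_trans (primitive_lip q_gt1 (u_01 x) (u_01 _)) _.
  rewrite [leRHS](_ : _ = (1 + 2 / a) `^ (q - 1) * u x `^ (q - 1) *
    (2 / a * step n)); last by ring.
  rewrite ler_pM ?powR_ge0//.
    rewrite -powRM ?(ltW ux0)//; last by lra.
    have h : Num.max (u x) (u (x + e (step n))) <= (1 + 2 / a) * u x.
      rewrite ge_max; apply/andP; split.
        by rewrite ler_peMl ?(ltW ux0)// lerDl.
      rewrite mulrDl mul1r -lerBlDl (le_trans (ler_norm _))// (le_trans (sb x n))//.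
      by rewrite ler_wpM2r ?(ltW ux0)// ler_piMr.
    have p0 : 0 <= Num.max (u x) (u (x + e (step n))) by rewrite le_max (ltW ux0).
    by rewrite ge0_ler_powR ?nnegrE// ?(le_trans p0 h)//; lra.
  apply: le_trans (sb x n) _; rewrite ler_piMr// mulr_ge0// ltW//.
have [|||iL cL] := @Rintegral_dominated_cvg _ V R mu g
  (fun x => f x * (clip (N + 1) (pi x) * du pi x))
  (fun x => M * u x `^ (q - 1)) mg _ _
  (integrable_scale M u_pow).
- apply: measurable_funM; first exact: measurable_nonlin_u.
  exact: measurable_funM.
- by apply: aeW => x; exact: gcvg.
- by apply: aeW => x n; exact: gM.
split=> //.
have mt := measurable_tent N.
have t01 x := tent_01 x N0.
have itF : mu.-integrable setT (EFin \o (fun x => tent N x * F x)).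
  apply: (integrable_boundedM (c := 1)) => // x.
  by have /andP[h1 h2] := t01 x; rewrite ger0_norm.
(* The inequality holds already for each difference quotient, by summation by parts and [tent_clip],
   and passes to the limit. *)
rewrite lerNr; apply: (cvgr_to_le cL); apply: nearW => n.
have s0 := @step_gt0 R n.
have s1 : step n <= 1 :> R by rewrite invf_le1 ?ltr0n// ler1n.
have id (t : R) : mu.-integrable setT
    (EFin \o (fun x => (clip (N + 1) (pi x) - clip (N + 1) (pi x - t)) * F x)).
  apply: (integrable_boundedM (c := (N + 1) + (N + 1))) => //.
    by apply: measurable_funB => //; exact: (measurable_clip_axis ax).
  by move=> x; rewrite (le_trans (ler_normB _ _))// lerD// clip_bound.
rewrite (_ : \int[mu]_x g n x =
  (step n)^-1 * \int[mu]_x (clip (N + 1) (pi x) * (F (x + e (step n)) - F x)));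
  last first.
  rewrite -RintegralZl//.
    by apply: eq_Rintegral => x _; rewrite /g mulrA mulrC.
  apply: (integrable_boundedM (c := N + 1)) => //.
    by move=> x; exact: clip_bound.
  have [i1 _] := Rintegral_shift (e (step n)) integrable_F.
  exact: (integrableB measurableT i1 integrable_F).
rewrite (summation_by_parts ax _ N1) mulrN lerN2 mulrC ler_pdivlMr//.
rewrite mulrC -(RintegralZl _ measurableT itF).
apply: le_Rintegral => //; first exact: integrable_scale itF.
move=> x _; rewrite mulrA ler_wpM2r// mulrC.
by apply: (tent_clip _ ax); rewrite ?(ltW s0).
Qed.


(** * Symmetrization of the double integral and conclusion for positive solutions *)

Let B := @bilin _ V R mu f.

Let kern N (pi : R * R * R -> R) (p : V * V) :=
  clip N (pi p.1) * dcalK a pi (p.1 - p.2).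

Let bounded_kern pi e N : axis pi e -> 0 <= N -> bounded_kernel (kern N pi).
Proof.
move=> ax N0; have [md [c dc]] := bounded_dcalK ax; have [mpi _ _ _ _] := ax.
split.
  apply: measurable_funM md.
  apply: (measurableT_comp (measurable_clip N)).
  exact: (measurableT_comp mpi).
exists (N * c) => p; rewrite normrM ler_pM ?clip_bound//; exact: dc.
Qed.

Let bilin_kern pi e N : axis pi e -> 0 < N ->
  \int[mu]_x (f x * (clip (N + 1) (pi x) * du pi x)) = C * B (kern (N + 1) pi).
Proof.
move=> ax N0; have [iL _] := axis_pohozaev ax N0.
have kE x : \int[mu]_y (kern (N + 1) pi (x, y) * f y) =
    clip (N + 1) (pi x) * \int[mu]_y (dcalK a pi (x - y) * f y).
  rewrite -(RintegralZl _ measurableT (integrable_dcalK ax x)).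
  by apply: eq_Rintegral => y _; rewrite mulrA.
have E x : f x * \int[mu]_y (kern (N + 1) pi (x, y) * f y) =
    C^-1 * (f x * (clip (N + 1) (pi x) * du pi x)).
  by rewrite kE /du; field; rewrite gt_eqF.
have -> : B (kern (N + 1) pi) =
    \int[mu]_x (C^-1 * (f x * (clip (N + 1) (pi x) * du pi x))).
  by apply: eq_Rintegral => x _; exact: E.
by rewrite (RintegralZl _ measurableT iL) mulrA divff ?gt_eqF// mul1r.
Qed.

(** Used with [I] the integral of [tent N x * F x], [J] that of [u x * f x], and one double integral
    [b1], [b2], [b3] per axis. *)
Let sum_axes_le (c b1 b2 b3 I J : R) : 0 < c ->
  I <= - (c * b1) -> I <= - (c * b2) -> I <= - (c * b3) ->
  0 <= 2 * (b1 + b2 + b3) + c^-1 * J -> 3 * I <= 2^-1 * J.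
Proof.
move=> c0 h1 h2 h3 h.
have : 0 <= c * (2 * (b1 + b2 + b3) + c^-1 * J) by rewrite mulr_ge0// ltW.
rewrite mulrDr [c * (c^-1 * J)]mulrA mulfV ?gt_eqF// mul1r; lra.
Qed.

(** Primed letters stand for the values after exchange of x and y, and [k] for the kernel. *)
Let antisymmetrized_sum (c1 c2 c3 c1' c2' c3' d1 d2 d3 d1' d2' d3' k : R) :
  d1' = - d1 -> d2' = - d2 -> d3' = - d3 ->
  - k <= (c1 - c1') * d1 + (c2 - c2') * d2 + (c3 - c3') * d3 ->
  0 <= c1 * d1 + c2 * d2 + c3 * d3 + (c1' * d1' + c2' * d2' + c3' * d3') + k.
Proof. by move=> -> -> ->; lra. Qed.

Lemma tent_pohozaev N : 0 < N ->
  3 * \int[mu]_x (tent N x * F x) <= 2^-1 * \int[mu]_x (u x * f x).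
Proof.
move=> N0; have N1 : 0 <= N + 1 by lra.
have a1 := @axis1 R; have a2 := @axis2 R; have a3 := @axis3 R.
have [_ h1] := axis_pohozaev a1 N0.
have [_ h2] := axis_pohozaev a2 N0.
have [_ h3] := axis_pohozaev a3 N0.
rewrite (bilin_kern a1 N0) in h1; rewrite (bilin_kern a2 N0) in h2.
rewrite (bilin_kern a3 N0) in h3.
have b1 := bounded_kern a1 N1; have b2 := bounded_kern a2 N1.
have b3 := bounded_kern a3 N1.
have b12 := bounded_kernelD b1 b2; have b123 := bounded_kernelD b12 b3.
have bS := bounded_kernel_swap b123.
have bG := bounded_kernelD b123 bS.
have BD g h := @bilinD _ V R mu f nonlin_u_ge0 integrable_nonlin_u g h.
(* [G] is the sum over the axes plus its image under exchange of x and y, so [B G] is twice the sum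
   of the three double integrals, while [G] is pointwise at least minus the kernel. *)
set G := fun p => _ in bG.
have H0 : 0 <= B (fun p => G p + calK a (p.1 - p.2)).
  apply: (@bilin_ge0 _ V R mu f nonlin_u_ge0) => -[x y].
  have := sum_dcalK a_gt0 x y N1 a1 a2 a3 (@norm3_sqr R).
  have s1 := dcalKN a (x - y) a1; have s2 := dcalKN a (x - y) a2.
  have s3 := dcalKN a (x - y) a3; rewrite opprB in s1 s2 s3.
  rewrite /G /kern. move=> hh /=.
  exact: (antisymmetrized_sum s1 s2 s3 hh).
(* The inner integral is [C^-1 * u x] by the integral equation. *)
have BK : B (fun p => calK a (p.1 - p.2)) = C^-1 * \int[mu]_x (u x * f x).
  rewrite -(RintegralZl _ measurableT integrable_uf).
  apply: eq_Rintegral => x _.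
  transitivity (f x * (C^-1 * u x)); last by ring.
  by congr (_ * _); rewrite u_sol mulrA mulVf ?gt_eqF// mul1r.
have BG : B (fun p => G p + calK a (p.1 - p.2)) =
    B G + B (fun p => calK a (p.1 - p.2)) by exact: BD.
have BGE : B G = 2 * (B (kern (N + 1) (fun x => x.1.1)) +
    B (kern (N + 1) (fun x => x.1.2)) + B (kern (N + 1) snd)).
  have e1 := BD _ _ b123 bS; have e2 := BD _ _ b12 b3; have e3 := BD _ _ b1 b2.
  have e4 := @bilin_swap _ V R mu f nonlin_u_ge0 integrable_nonlin_u _ b123.
  have e5 := etrans e2 (congr1 (fun t => t + _) e3).
  rewrite mulr_natl mulr2n; apply: (etrans e1).
  by congr (_ + _); [exact: e5|exact: etrans e4 e5].
rewrite BG BGE BK in H0.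
exact: (sum_axes_le C_gt0 h1 h2 h3 H0).
Qed.

Lemma pohozaev_le : 3 * \int[mu]_x F x <= 2^-1 * \int[mu]_x (u x * f x).
Proof.
have FF := ae_filter.
have [|||_ cF] := @Rintegral_dominated_cvg _ V R mu
  (fun n x => tent n.+1%:R x * F x) F F
  _ measurable_F _ integrable_F.
- by move=> n; apply: measurable_funM => //; exact: measurable_tent.
- apply: aeW => x; rewrite -[X in _ --> X]mul1r.
  by apply: cvgM; [exact: tent_cvg|exact: cvg_cst].
- apply: aeW => x n; have /andP[h1 h2] := tent_01 x (ltr0Sn R n).
  by rewrite ger0_norm ?mulr_ge0// ler_piMl.
have c3 : 3 * \int[mu]_x (tent n.+1%:R x * F x) @[n --> \oo] --> 3 * \int[mu]_x F x.
  by apply: cvgM; [exact: cvg_cst|exact: cF].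
by apply: (cvgr_to_le c3); apply: nearW => n; exact: tent_pohozaev.
Qed.

Lemma pohozaev_contradiction : q <= 6 -> False.
Proof.
move=> q6; have FF := ae_filter.
pose D x := 3 * F x - 2^-1 * (u x * f x).
have D0 x : 0 < D x.
  rewrite subr_gt0 mulrC; apply: pohozaev_density_gt0 (u_01 x).
  by rewrite q_gt1.
have iD : mu.-integrable setT (EFin \o D).
  exact: (integrableB measurableT (integrable_scale 3 integrable_F)
    (integrable_scale 2^-1 integrable_uf)).
have ID : \int[mu]_x D x <= 0.
  rewrite (RintegralB measurableT (integrable_scale 3 integrable_F)
    (integrable_scale 2^-1 integrable_uf)).
  rewrite (RintegralZl _ measurableT integrable_F).
  rewrite (RintegralZl _ measurableT integrable_uf).
  by rewrite subr_le0 pohozaev_le.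
have ID0 : (\int[mu]_x `|(D x)%:E| = 0)%E.
  under eq_integral do rewrite gee0_abs ?lee_fin ?(ltW (D0 _))//.
  rewrite -EFin_Rintegral//; congr (_%:E); apply/eqP; rewrite eq_le ID/=.
  by apply: Rintegral_ge0 => x _; exact: ltW.
have mD := (measurable_EFinP _ _).2 (integrable_measurable iD).
have /(_ mD) /iffLR /(_ ID0) ae0 :=
  @ae_eq_integral_abs _ V R mu setT measurableT (EFin \o D).
(* [D] vanishes almost everywhere but is positive everywhere, so the whole space would be null. Then
   the integral in the equation at the origin is 0, against [u 0 > 0]. *)
have null : {ae mu, forall x, False}.
  by apply: filterS ae0 => x /(_ I) /= [Dx]; have := D0 x; rewrite Dx ltxx.
have u0 : u 0 = 0.
  rewrite u_sol [X in _ * X](_ : _ = 0) ?mulr0//.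
  rewrite /Rintegral (ae_eq_integral (cst 0%E)) ?integral0//.
  - exact: ((measurable_EFinP _ _).2 (integrable_measurable (integrable_calK 0))).
  - by apply: filterS null.
by have := u_01 0; rewrite u0 ltxx.
Qed.

End Pohozaev.

(** * Deduction of the two rigidity statements *)

Theorem theorem1p7 (R : realType) (a l C q : R) (u : R * R * R -> R)
  (a_gt0 : 0 < a) (C_gt0 : 0 < C) (q_gt1 : 1 < q)
  (u_unif : unif_continuous u)
  (u_diff : forall x : R * R * R, differentiable u x)
  (u_sol : forall x : R * R * R,
    ((u x)%:E = l%:E + C%:E *
       \int[lebesgue_measure3 R]_y
         (calK a (x - y) * (u y `^ (q - 1) * (1 - u y `^ q)))%:E)%E)
  (u_01 : forall x : R * R * R, 0 <= u x <= 1)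
  (u_fin : (\int[lebesgue_measure3 R]_x
     (u x `^ (q - 1) * (1 - u x `^ q))%:E < +oo)%E) :
  ((\int[lebesgue_measure3 R]_x (`|u x| `^ (q - 1))%:E < +oo)%E ->
     l = 0 -> 1 < q <= 6 -> forall x : R * R * R, u x = 0) /\
  ((lebesgue_measure3 R).-integrable setT (fun x => (1 - u x `^ q)%:E) ->
     l = 1 -> forall x : R * R * R, u x = 1).
Proof.
have f0 x : 0 <= nonlin q (u x) by have /andP[] := nonlin_01 q_gt1 (u_01 x).
have Kf0 x y : 0 <= calK a (x - y) * nonlin q (u y).
  by rewrite mulr_ge0 ?calK_ge0.
split=> [u_int l0 /andP[_ q6] x0|_ l1 x]; last first.
  apply/eqP; rewrite eq_le; have /andP[_ ->] /= := u_01 x.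
  rewrite -lee_fin u_sol l1 leeDl// mule_ge0 ?lee_fin ?(ltW C_gt0)//.
  by apply: integral_ge0 => y _; rewrite lee_fin; exact: Kf0.
have mu_u : measurable_fun [set: space R] u.
  by apply: continuous_measurable3 => x; exact: differentiable_continuous (u_diff x).
have mp p : measurable_fun [set: space R] (fun x => u x `^ p).
  exact: (measurableT_comp (measurable_powR _)).
have u_pow : (@lebesgue3 R).-integrable setT (EFin \o (fun x => u x `^ (q - 1))).
  apply: ge0_fin_integrable => // [x|]; first exact: powR_ge0.
  move: u_int; congr (_ < _)%E; apply: eq_integral => x _.
  by have /andP[u0 _] := u_01 x; rewrite ger0_norm.
have mf : measurable_fun [set: space R] (fun x => nonlin q (u x)).
  by apply: measurable_funM => //; exact: measurable_funB.
have mKf x : measurable_fun [set: space R]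
    (fun y => calK a (x - y) * nonlin q (u y)).
  apply: measurable_funM => //; apply: (measurableT_comp (measurable_calK a)).
  exact: (measurableT_comp measurable_subr (pair1_measurable x)).
have uE x : ((u x)%:E = C%:E * \int[lebesgue_measure3 R]_y
    (calK a (x - y) * nonlin q (u y))%:E)%E by rewrite u_sol l0 add0e.
have [u_pos|] := pselect (forall x, 0 < u x).
  exfalso; apply: (@pohozaev_contradiction R a C q u) => //.
  - by move=> x; rewrite u_pos; have /andP[] := u_01 x.
  move=> x; have := uE x; rewrite /Rintegral.
  (* An infinite integral multiplied by [C > 0] could not equal the real number [u x], so the
     equation also holds for the real-valued integral. *)
  case: (\int[_]_y _)%E => [r [->]//| |].
    by rewrite gt0_muley ?lte_fin.
  by rewrite gt0_muleNy ?lte_fin.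
move=> /existsNP[x1 /negP]; rewrite -leNgt => ux1.
have u1 : u x1 = 0 by apply/eqP; rewrite eq_le ux1; have /andP[] := u_01 x1.
have FF : Filter (nbhs (almost_everywhere (@lebesgue_measure3 R))).
  exact: (@ae_filter_ringOfSetsType _ (space R) R (@lebesgue_measure3 R)).
have I0 : (\int[lebesgue_measure3 R]_y (calK a (x1 - y) * nonlin q (u y))%:E = 0)%E.
  have /eqP := uE x1; rewrite u1 eq_sym mule_eq0 eqe gt_eqF//=.
  by move/eqP.
have ae0 : {ae @lebesgue_measure3 R, forall y, nonlin q (u y) = 0}.
  have I0' : (\int[lebesgue_measure3 R]_y
      `|(calK a (x1 - y) * nonlin q (u y))%:E| = 0)%E.
    by rewrite -[RHS]I0; apply: eq_integral => y _; rewrite gee0_abs// lee_fin.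
  have mE := (measurable_EFinP _ _).2 (mKf x1).
  have aeK := (@ae_eq_integral_abs _ (space R) R
    (@lebesgue_measure3 R) setT measurableT _ mE).1 I0'.
  (* Away from the zero [x1] of [u] the kernel is positive, so the vanishing product forces the
     nonlinearity to vanish. *)
  apply: filterS2 (ae_neq x1) aeK => y yx /(_ I) [/eqP].
  rewrite mulf_eq0 gt_eqF/=; first by move/eqP.
  by rewrite calK_gt0// subr_eq0 eq_sym.
(* The equation at an arbitrary point now has an integrand that is 0 almost everywhere. *)
apply: EFin_inj; rewrite uE [X in (_ * X)%E](_ : _ = 0%E) ?mule0//.
rewrite (ae_eq_integral (cst 0%E)) ?integral0//.
- exact: ((measurable_EFinP _ _).2 (mKf x0)).
- by apply: filterS ae0 => y /= -> _; rewrite mulr0.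
Qed.
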